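(* For every $k\in\mathbb{N}$, with \[ F_{k,1}(q)=\sum_{n\ge 0}\frac{\left(q^{2n+2};q^2\right)_\infty\left(q^{2n+2k};q^2\right)_\infty}{\left(q^{2n+1};q^2\right)_\infty^2}\,q^{2n+1} \quad\text{and}\quad \omega(q)=\sum_{n\ge0}\frac{q^{2n(n+1)}}{\left(q;q^2\right)_{n+1}^2}, \] we have \[ q\,\omega(q)-F_{k,1}(q)=q^{2k+1}E_k(q) \] for some formal power series $E_k(q)\in\mathbb{Z}[[q]]$ whose constant coefficient equals $1$.
   Context: For $n\in\mathbb{N}_0\cup\{\infty\}$, $(a;q)_n:=\prod_{j=0}^{n-1}(1-aq^j)$. All series are formal power series in $q$. *)

(* Defs.v *)
From HB Require Import structures.
From mathcomp Require Import all_boot all_order all_algebra.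
From mathcomp Require Import boolp classical_sets.

Set Implicit Arguments.
Unset Strict Implicit.
Unset Printing Implicit Defensive.

Import Order.TTheory GRing.Theory Num.Theory.
Local Open Scope ring_scope.

(* R[[q]], as a record rather than the bare function type [nat -> R], on which
   the multiplication would be pointwise. *)
Record fps (R : Type) := Fps { fps_coef : nat -> R }.
Arguments Fps {R} fps_coef.
Arguments fps_coef {R} f m : rename.

HB.instance Definition _ (R : Type) := gen_eqMixin (fps R).
HB.instance Definition _ (R : Type) := gen_choiceMixin (fps R).

Lemma fpsP (R : Type) (f g : fps R) : fps_coef f =1 fps_coef g <-> f = g.
Proof. by split=> [|-> //]; case: f g => f [g] /= /funext ->. Qed.

Section FpsRing.
Variable R : comNzRingType.
Implicit Types f g h : fps R.

Definition fps_zero : fps R := Fps (fun=> 0).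
Definition fps_opp f := Fps (fun m => - fps_coef f m).
Definition fps_add f g := Fps (fun m => fps_coef f m + fps_coef g m).
Definition fps_one : fps R := Fps (fun m => (m == 0%N)%:R).
Definition fps_mul f g :=
  Fps (fun m => \sum_(i < m.+1) fps_coef f i * fps_coef g (m - i)).

Fact fps_addA : associative fps_add.
Proof. by move=> f g h; apply/fpsP => m /=; rewrite addrA. Qed.
Fact fps_addC : commutative fps_add.
Proof. by move=> f g; apply/fpsP => m /=; rewrite addrC. Qed.
Fact fps_add0 : left_id fps_zero fps_add.
Proof. by move=> f; apply/fpsP => m /=; rewrite add0r. Qed.
Fact fps_addN : left_inverse fps_zero fps_opp fps_add.
Proof. by move=> f; apply/fpsP => m /=; rewrite addNr. Qed.

HB.instance Definition _ :=
  GRing.isZmodule.Build (fps R) fps_addA fps_addC fps_add0 fps_addN.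

Definition fps_trunc n f : {poly R} := \poly_(i < n) fps_coef f i.

Lemma coef_fps_trunc n f i : (i < n)%N -> (fps_trunc n f)`_i = fps_coef f i.
Proof. by move=> lt_in; rewrite coef_poly lt_in. Qed.

Lemma coef_fps_truncM n f g i : (i < n)%N ->
  (fps_trunc n f * fps_trunc n g)`_i = fps_coef (fps_mul f g) i.
Proof.
move=> lt_in; rewrite coefM; apply: eq_bigr => j _.
have le_ji : (j <= i)%N by rewrite -ltnS.
by rewrite !coef_fps_trunc // (leq_ltn_trans _ lt_in) // leq_subr.
Qed.

Fact fps_mulC : commutative fps_mul.
Proof.
by move=> f g; apply/fpsP => m; rewrite -!(coef_fps_truncM _ _ (ltnSn m)) mulrC.
Qed.

Fact fps_mulA : associative fps_mul.
Proof.
move=> f g h; apply/fpsP => m; pose t := fps_trunc m.+1.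
have tM f1 f2 i : (i <= m)%N -> (t (fps_mul f1 f2))`_i = (t f1 * t f2)`_i.
  by move=> le_im; rewrite coef_fps_trunc // coef_fps_truncM.
rewrite -!(coef_fps_truncM _ _ (ltnSn m)) -/t.
transitivity ((t f * (t g * t h))`_m).
  by rewrite !(coefM (t f)); apply: eq_bigr => i _; rewrite tM ?leq_subr.
rewrite mulrA !(coefM _ (t h)); apply: eq_bigr => i _.
by rewrite tM // -ltnS.
Qed.

Fact fps_mul1 : left_id fps_one fps_mul.
Proof.
move=> f; apply/fpsP => m /=; rewrite big_ord_recl /= mul1r subn0.
by rewrite big1 ?addr0 // => i _; rewrite mul0r.
Qed.

Fact fps_mulDl : left_distributive fps_mul fps_add.
Proof.
move=> f g h; apply/fpsP => m /=; rewrite -big_split /=.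
by apply: eq_bigr => i _; rewrite mulrDl.
Qed.

Fact fps_1neq0 : fps_one != 0.
Proof.
by apply/eqP => /fpsP/(_ 0%N) /= /eqP; rewrite oner_eq0.
Qed.

HB.instance Definition _ := GRing.Zmodule_isComNzRing.Build (fps R)
  fps_mulA fps_mulC fps_mul1 fps_mulDl fps_1neq0.

Lemma fps_coefM f g m :
  fps_coef (f * g) m = \sum_(i < m.+1) fps_coef f i * fps_coef g (m - i).
Proof. by []. Qed.

Definition fps_unit : {pred fps R} := fun f => `[< exists g, g * f = 1 >].
Definition fps_inv f : fps R := xget f [set g | g * f = 1]%classic.

Fact fps_mulV : {in fps_unit, left_inverse 1 fps_inv *%R}.
Proof. by move=> f /asboolP[g gf]; apply: (@xgetI _ f [set g | g * f = 1]%classic g gf). Qed.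

Fact fps_unitP f g : g * f = 1 -> fps_unit f.
Proof. by move=> gf; apply/asboolP; exists g. Qed.

Fact fps_inv_out : {in [predC fps_unit], fps_inv =1 id}.
Proof.
move=> f /asboolP nf; rewrite /fps_inv xgetPN // => g gf.
by apply: nf; exists g.
Qed.

HB.instance Definition _ := GRing.ComNzRing_hasMulInverse.Build (fps R)
  fps_mulV fps_unitP fps_inv_out.

Definition fpsX : fps R := Fps (fun m => (m == 1%N)%:R).

(* Limit for the q-adic topology of R[[q]] with R discrete: the m-th
   coefficient is the eventual value of the m-th coefficients (0 if there is
   none, see fps_limP for the convergent case). *)
Definition fps_lim (u : nat -> fps R) : fps R :=
  Fps (fun m =>
    xget 0 [set c | exists N, forall n, (N <= n)%N -> fps_coef (u n) m = c]%classic).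

Lemma fps_limP (u : nat -> fps R) f :
  (forall m, exists N, forall n, (N <= n)%N ->
     fps_coef (u n) m = fps_coef f m) ->
  fps_lim u = f.
Proof.
move=> uf; apply/fpsP => m /=; apply: xget_unique; first exact: uf.
have [N1 e1] := uf m; move=> c [N2 e2].
by rewrite -(e2 (maxn N1 N2)) ?leq_maxr // e1 ?leq_maxl.
Qed.

Definition fps_sum (u : nat -> fps R) : fps R :=
  fps_lim (fun N => \sum_(n < N) u n).

Definition qpoch (a q : fps R) (n : nat) : fps R :=
  \prod_(j < n) (1 - a * q ^+ j).
Definition qpoch_inf (a q : fps R) : fps R := fps_lim (qpoch a q).

(* Criteria under which the inverse and the limits above are the genuine ones,
   rather than default values; F_k1 k (for k > 0) and omega below meet them. *)
Lemma fps_unit_coef0 f : fps_coef f 0 = 1 -> f \is a GRing.unit.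
Proof.
move=> f0; apply/unitrPr.
pose step (s : seq R) :=
  rcons s ((size s == 0%N)%:R
           - \sum_(i < size s) fps_coef f i.+1 * s`_(size s - i.+1)).
pose s n := iter n step [::].
have szs n : size (s n) = n by elim: n => //= n IHn; rewrite size_rcons IHn.
have nths n k i : (i < n)%N -> (s (n + k)%N)`_i = (s n)`_i.
  move=> lt_in; elim: k => [|k IHk]; rewrite ?addn0 // addnS /= nth_rcons szs.
  by rewrite (leq_trans lt_in (leq_addr _ _)).
exists (Fps (fun i => (s i.+1)`_i)); apply/fpsP => m.
have sE : (s m.+1)`_m =
    (m == 0%N)%:R - \sum_(i < m) fps_coef f i.+1 * (s m)`_(m - i.+1).
  by rewrite {1}/s iterS {1}/step -/(s m) nth_rcons szs ltnn eqxx.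
rewrite fps_coefM big_ord_recl f0 mul1r [fps_coef (Fps _) _]/= subn0 sE.
rewrite addrAC -addrA (_ : _ - _ = 0) ?addr0 //; apply/eqP.
rewrite subr_eq0; apply/eqP/eq_bigr => i _; congr (_ * _).
by have := nths _ i _ (ltnSn (m - i.+1)%N); rewrite addSn -addnS subnK // => ->.
Qed.

Lemma fps_coefXnM e f m :
  fps_coef (fpsX ^+ e * f) m = if (m < e)%N then 0 else fps_coef f (m - e).
Proof.
elim: e f m => [|e IHe] f m; first by rewrite expr0 mul1r subn0.
rewrite exprSr -mulrA IHe ltnS; case: (ltnP m e) => [/ltnW-> //|le_em].
rewrite fps_coefM; case: (ltngtP m e) le_em => // [lt_em|->] _; last first.
  by rewrite subnn big_ord1 mul0r.
case: (m - e)%N (subnS m e) (subn_gt0 e m) => [|d]; first by rewrite lt_em.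
move=> /= -> _; rewrite !big_ord_recl /= mul0r mul1r add0r subSS subn0.
by rewrite big1 ?addr0 // => i _; rewrite mul0r.
Qed.

Lemma fps_coefB f g m : fps_coef (f - g) m = fps_coef f m - fps_coef g m.
Proof. by []. Qed.

Lemma fps_coefD f g m : fps_coef (f + g) m = fps_coef f m + fps_coef g m.
Proof. by []. Qed.

Lemma fps_lim_coef (u : nat -> fps R) m N :
  (forall n, (N <= n)%N -> fps_coef (u n.+1) m = fps_coef (u n) m) ->
  forall n, (N <= n)%N -> fps_coef (fps_lim u) m = fps_coef (u n) m.
Proof.
move=> uS n le_Nn.
have uE k : (N <= k)%N -> fps_coef (u k) m = fps_coef (u N) m.
  by move=> /subnKC <-; elim: (k - N)%N => [|i IHi];
     rewrite ?addn0 // addnS uS ?leq_addr.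
rewrite (uE n) //=; apply: xget_unique; first by exists N.
by move=> c [N' uc]; rewrite -(uc (maxn N N')) ?leq_maxr // uE ?leq_maxl.
Qed.

Lemma fps_sum_coef (u : nat -> fps R) m N :
  (forall n, (N <= n)%N -> fps_coef (u n) m = 0) ->
  fps_coef (fps_sum u) m = fps_coef (\sum_(n < N) u n) m.
Proof.
move=> u0; apply: (fps_lim_coef (N := N)) => // n le_Nn.
by rewrite big_ord_recr fps_coefD u0 ?addr0.
Qed.

Lemma qpoch_inf_coef a b m N : (0 < a)%N -> (0 < b)%N -> (m <= N)%N ->
  fps_coef (qpoch_inf (fpsX ^+ a) (fpsX ^+ b)) m =
  fps_coef (qpoch (fpsX ^+ a) (fpsX ^+ b) N) m :> R.
Proof.
move=> a0 b0; apply: fps_lim_coef => n le_mn.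
have -> (x y : fps R) : qpoch x y n.+1 = qpoch x y n * (1 - x * y ^+ n).
  exact: big_ord_recr.
rewrite mulrBr mulr1 fps_coefB -exprM -exprD mulrC.
rewrite fps_coefXnM ifT ?subr0 // -add1n leq_add //.
by rewrite (leq_trans le_mn) // leq_pmull.
Qed.

Lemma qpoch_coef0 a b N : (0 < a)%N ->
  fps_coef (qpoch (fpsX ^+ a) (fpsX ^+ b) N) 0 = 1 :> R.
Proof.
move=> a0; rewrite /qpoch; elim/big_rec: _ => // i f _ f0.
rewrite mulrBl mul1r fps_coefB f0 -exprM -exprD fps_coefXnM.
by rewrite addn_gt0 a0 subr0.
Qed.

Lemma qpoch_unit a b N : (0 < a)%N ->
  qpoch (fpsX ^+ a) (fpsX ^+ b) N \is a @GRing.unit (fps R).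
Proof. by move=> a0; apply: fps_unit_coef0; apply: qpoch_coef0. Qed.

Lemma qpoch_inf_unit a b : (0 < a)%N -> (0 < b)%N ->
  qpoch_inf (fpsX ^+ a) (fpsX ^+ b) \is a @GRing.unit (fps R).
Proof.
move=> a0 b0; apply: fps_unit_coef0.
by rewrite (@qpoch_inf_coef _ _ _ 0) // qpoch_coef0.
Qed.

End FpsRing.

Arguments fpsX {R}.

Section Series.
Local Notation q := (@fpsX int).

Definition F_k1 (k : nat) : fps int :=
  fps_sum (fun n =>
    qpoch_inf (q ^+ (2 * n + 2)) (q ^+ 2)
    * qpoch_inf (q ^+ (2 * n + 2 * k)) (q ^+ 2)
    / qpoch_inf (q ^+ (2 * n + 1)) (q ^+ 2) ^+ 2
    * q ^+ (2 * n + 1)).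

Definition omega : fps int :=
  fps_sum (fun n => q ^+ (2 * n * (n + 1)) / qpoch q (q ^+ 2) (n + 1) ^+ 2).

End Series.

(* Main.v *)
Require Import Defs.
From mathcomp Require Import all_boot all_order all_algebra.
From mathcomp Require Import ring zify.
Import GRing.Theory.
Local Open Scope ring_scope.

(** Put [p = q^2], [x = q^(2j+1)], and consider the two families
    [C_j = sum_n p^n (p^(n+1); p)_oo / (x p^n; p)_oo^2] and
    [T_j = sum_n q^(2n(n+1) + 4jn) / (x; p)_(n+1)^2].
    Both satisfy [(1 - x)^2 S_j = 1 + x^2 p S_(j+1)]: for [T_j] by splitting off
    the term [n = 0], for [C_j] by telescoping.  Iterating, [C_j - T_j] is
    divisible by every power of [q], so [C_0 = T_0 = omega].  Finally [q C_0] is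
    the limit of [F_{k,1}] for [k] to infinity, and in
    [q C_0 - F_{k,1} = sum_n q^(2n+1) (...) (1 - (p^(n+k); p)_oo)]
    only the term [n = 0] contributes below [q^(2k+2)], namely [q^(2k+1)]. *)

(** * Congruence of formal power series modulo powers of q *)

Section Congruence.
Set Implicit Arguments.
Unset Strict Implicit.

Variable R : comNzRingType.
Implicit Types (f g h : fps R) (u : nat -> fps R).

(** The explicit cofactor [h] lets [ring] prove compatibility with sums and products; [fps_eqmP]
    gives the coefficientwise form. *)
Definition fps_eqm N f g := exists h, f = g + fpsX ^+ N * h.

Lemma fps_eqmP N f g :
  fps_eqm N f g <-> forall m, (m < N)%N -> fps_coef f m = fps_coef g m.
Proof.
split=> [[h ->] m lt_mN|fg].
  by rewrite fps_coefD fps_coefXnM lt_mN addr0.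
exists (Fps (fun m => fps_coef (f - g) (m + N))); apply/fpsP => m.
rewrite fps_coefD fps_coefXnM; case: ltnP => [/fg->|le_Nm]; rewrite ?addr0 //.
by rewrite /= subnK // addrC subrK.
Qed.

Lemma fps_eqm_refl N f : fps_eqm N f f.
Proof. by apply/fps_eqmP. Qed.

Lemma fps_eqm_sym N f g : fps_eqm N f g -> fps_eqm N g f.
Proof. by move=> /fps_eqmP fg; apply/fps_eqmP => m /fg. Qed.

Lemma fps_eqm_trans N g f h : fps_eqm N f g -> fps_eqm N g h -> fps_eqm N f h.
Proof.
by move=> /fps_eqmP fg /fps_eqmP gh; apply/fps_eqmP => m ltmN; rewrite fg ?gh.
Qed.

Lemma fps_eqm_leq M N f g : (M <= N)%N -> fps_eqm N f g -> fps_eqm M f g.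
Proof.
move=> leMN /fps_eqmP fg; apply/fps_eqmP => m ltmM.
by apply: fg; apply: leq_trans leMN.
Qed.

Lemma fps_eqm_eq f g : (forall N, fps_eqm N f g) -> f = g.
Proof. by move=> fg; apply/fpsP => m; have /fps_eqmP := fg m.+1; apply. Qed.

Lemma fps_eqmD N f f' g g' :
  fps_eqm N f f' -> fps_eqm N g g' -> fps_eqm N (f + g) (f' + g').
Proof. by move=> [h ->] [h' ->]; exists (h + h'); ring. Qed.

Lemma fps_eqmM N f f' g g' :
  fps_eqm N f f' -> fps_eqm N g g' -> fps_eqm N (f * g) (f' * g').
Proof.
move=> [h ->] [h' ->]; exists (f' * h' + h * g' + fpsX ^+ N * h * h'); ring.
Qed.

Lemma fps_eqmB N f f' g g' :
  fps_eqm N f f' -> fps_eqm N g g' -> fps_eqm N (f - g) (f' - g').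
Proof. by move=> [h ->] [h' ->]; exists (h - h'); ring. Qed.

Lemma fps_eqmX0 N f : fps_eqm N (fpsX ^+ N * f) 0.
Proof. by exists f; rewrite add0r. Qed.

Lemma fps_eqmXM M N f g :
  fps_eqm N f g -> fps_eqm (M + N) (fpsX ^+ M * f) (fpsX ^+ M * g).
Proof. by move=> [h ->]; exists h; rewrite exprD; ring. Qed.

Lemma fps_eqm1_unit N f : fps_eqm N.+1 f 1 -> f \is a GRing.unit.
Proof. by move=> /fps_eqmP f1; apply: fps_unit_coef0; rewrite f1. Qed.

(** The modulus is a positive power, so [f] has constant coefficient 1 and is invertible; it remains
    to multiply [f] = 1 by [f^-1]. *)
Lemma fps_eqm1V N f : fps_eqm N.+1 f 1 -> fps_eqm N.+1 f^-1 1.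
Proof.
move=> f1; have uf := fps_eqm1_unit f1.
have := fps_eqmM (fps_eqm_refl N.+1 f^-1) f1.
by rewrite mulVr // mulr1 => /fps_eqm_sym.
Qed.

Lemma fps_eqm_sum N u : (forall n, fps_eqm n (u n) 0) ->
  fps_eqm N (fps_sum u) (\sum_(n < N) u n).
Proof.
move=> u0; apply/fps_eqmP => m lt_mN; apply: fps_sum_coef => n le_Nn.
by have /fps_eqmP := u0 n; apply; apply: leq_trans le_Nn.
Qed.

(** Each use of the recurrence gains a factor [fpsX]: if all [D j] are divisible by its [N]-th
    power, then all are divisible by the next one. The induction therefore treats all [j] at
    once. *)
Lemma fps_eqm_recr N (c d D : nat -> fps R) :
  (forall j, c j \is a GRing.unit) -> (forall j, D j * c j = fpsX * d j * D j.+1) ->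
  forall j, fps_eqm N (D j) 0.
Proof.
move=> cU DS; elim: N => [|N IH] j; first by apply/fps_eqmP.
have -> : D j = fpsX ^+ 1 * (d j * D j.+1 / c j).
  by rewrite expr1 !mulrA -DS mulrK.
have [h ->] := IH j.+1; exists (d j * h / c j).
by rewrite expr1 exprS; move: (c j)^-1 (fpsX ^+ N) => v y; ring.
Qed.

Lemma qpochS (a q : fps R) n : qpoch a q n.+1 = (1 - a) * qpoch (a * q) q n.
Proof.
rewrite /qpoch big_ord_recl expr0 mulr1; congr (_ * _).
by apply: eq_bigr => i _; rewrite exprS mulrA.
Qed.

Lemma qpoch_infS a b : (0 < a)%N -> (0 < b)%N ->
  qpoch_inf (fpsX ^+ a) (fpsX ^+ b) =
  (1 - fpsX ^+ a) * qpoch_inf (fpsX ^+ (a + b)) (fpsX ^+ b) :> fps R.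
Proof.
move=> a0 b0; have inf_eqm c N : (0 < c)%N ->
    fps_eqm N (qpoch_inf (fpsX ^+ c) (fpsX ^+ b) : fps R)
              (qpoch (fpsX ^+ c) (fpsX ^+ b) N).
  by move=> c0; apply/fps_eqmP => m /ltnW; apply: qpoch_inf_coef.
apply: fps_eqm_eq => N.
(* The left product is cut after [N.+1] factors, so that [N] remain once the first is removed. *)
apply: (fps_eqm_trans (fps_eqm_leq (leqnSn N) (inf_eqm a N.+1 a0))).
rewrite qpochS -exprD; apply: fps_eqmM (fps_eqm_refl _ _) _.
by apply: fps_eqm_sym; apply: inf_eqm; rewrite addn_gt0 a0.
Qed.

Lemma qpoch_inf_eqm1 a b : (0 < a)%N -> (0 < b)%N ->
  fps_eqm a (qpoch_inf (fpsX ^+ a) (fpsX ^+ b) : fps R) 1.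
Proof.
move=> a0 b0; apply/fps_eqmP => m lt_ma; rewrite (@qpoch_inf_coef _ _ _ _ m) //.
suff /fps_eqmP : fps_eqm a (qpoch (fpsX ^+ a) (fpsX ^+ b) m : fps R) 1 by apply.
rewrite /qpoch; elim/big_rec: _ => [|i f _ f1]; first exact: fps_eqm_refl.
rewrite -[1]mulr1; apply: fps_eqmM f1.
by exists (- (fpsX ^+ b) ^+ i); rewrite mulrN mulr1.
Qed.

(** After the factor [1 - fpsX ^+ a] is extracted, the remaining product is 1 modulo
    [fpsX ^+ (a + b)], and [b] is positive. *)
Lemma qpoch_inf_eqm_lead a b : (0 < a)%N -> (0 < b)%N ->
  fps_eqm a.+1 (1 - qpoch_inf (fpsX ^+ a) (fpsX ^+ b) : fps R) (fpsX ^+ a).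
Proof.
move=> a0 b0; rewrite qpoch_infS // -[X in fps_eqm _ _ X](subKr 1).
rewrite -[X in fps_eqm _ _ (_ - X)]mulr1.
apply: (fps_eqmB (fps_eqm_refl _ _)); apply: (fps_eqmM (fps_eqm_refl _ _)).
by apply: fps_eqm_leq (qpoch_inf_eqm1 _ b0); rewrite ?addn_gt0 ?a0 //; lia.
Qed.

End Congruence.

(** * Algebraic identities behind the recurrences *)

Lemma divr_sqrMK (R : comUnitRingType) (a b c : R) :
  a \is a GRing.unit -> b \is a GRing.unit ->
  c / (a * b) ^+ 2 * a ^+ 2 = c / b ^+ 2.
Proof.
move=> ua ub; rewrite exprMn.
have := unitrX 2 ua; have := unitrX 2 ub.
move: (a ^+ 2) (b ^+ 2) => {ua ub}a {}b ub ua.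
by rewrite invrM // mulrA divrK.
Qed.

(* The certificate [(1 - y) (1 - x^2 y)], with [y = p^N], is found by solving
   for a polynomial in [y] that vanishes at [1] and takes the value [1] at [0]. *)
Lemma weighted_sum_telescope (R : comNzRingType) (p x : R) (w w' : nat -> R) N :
  (forall n, w' n = w n * (1 - x * p ^+ n) ^+ 2) ->
  (forall n, w n.+1 * (1 - p ^+ n.+1) = w n * (1 - x * p ^+ n) ^+ 2) ->
  (1 - x) ^+ 2 * (\sum_(n < N) p ^+ n * w n)
  - x ^+ 2 * p * (\sum_(n < N) p ^+ n * w' n)
  = w N * (1 - p ^+ N) * (1 - x ^+ 2 * p ^+ N).
Proof.
move=> w'E wS; elim: N => [|N IH]; first by rewrite !big_ord0 expr0; ring.
rewrite wS !big_ord_recr /= (mulrDr ((1 - x) ^+ 2)) (mulrDr (x ^+ 2 * p)).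
by rewrite opprD addrACA IH w'E (exprS p N); move: (p ^+ N) => y; ring.
Qed.

(** * The common recurrence of [C_j] and [T_j], and the identity [omega = C_0] *)

Section OmegaAsLimit.
Set Implicit Arguments.
Unset Strict Implicit.

Local Notation q := (@fpsX int).

(** For [j = 0] this is the quotient in the [n]-th summand of [F_k1 k] without the factor depending
    on [k]. Below, [limit_series j] is [C_j] and [omega_tail j] is [T_j]. *)
Definition limit_weight j n : fps int :=
  qpoch_inf (q ^+ (2 * n + 2)) (q ^+ 2)
  / qpoch_inf (q ^+ (2 * n + 2 * j + 1)) (q ^+ 2) ^+ 2.

Definition limit_series j : fps int :=
  fps_sum (fun n => q ^+ (2 * n) * limit_weight j n).

Definition omega_tail j : fps int :=
  fps_sum (fun n => q ^+ (2 * n * (n + 1) + 4 * j * n)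
                    / qpoch (q ^+ (2 * j + 1)) (q ^+ 2) (n + 1) ^+ 2).

Lemma one_subX_unit a : (0 < a)%N -> (1 - q ^+ a) \is a GRing.unit.
Proof.
by case: a => // a _; apply: (@fps_eqm1_unit _ a); exists (-1); rewrite mulrN1.
Qed.

Lemma limit_weightSj j n :
  limit_weight j.+1 n = limit_weight j n * (1 - q ^+ (2 * n + 2 * j + 1)) ^+ 2.
Proof.
rewrite /limit_weight (@qpoch_infS _ (2 * n + 2 * j + 1)) //; last by lia.
have -> : (2 * n + 2 * j.+1 + 1 = 2 * n + 2 * j + 1 + 2)%N by lia.
have uA : (1 - q ^+ (2 * n + 2 * j + 1)) \is a GRing.unit.
  by apply: one_subX_unit; lia.
have uB : qpoch_inf (q ^+ (2 * n + 2 * j + 1 + 2)) (q ^+ 2) \is a GRing.unit.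
  by apply: qpoch_inf_unit; lia.
by rewrite divr_sqrMK.
Qed.

(** The denominator depends only on [n + j], so raising [n] acts on it as raising [j] does; the
    numerator also loses its first factor. *)
Lemma limit_weightSn j n :
  limit_weight j n.+1 * (1 - q ^+ (2 * n + 2)) =
  limit_weight j n * (1 - q ^+ (2 * n + 2 * j + 1)) ^+ 2.
Proof.
rewrite -(limit_weightSj j n) /limit_weight (@qpoch_infS _ (2 * n + 2)) //; last by lia.
have -> : (2 * n.+1 + 2 = 2 * n + 2 + 2)%N by lia.
have -> : (2 * n.+1 + 2 * j + 1 = 2 * n + 2 * j.+1 + 1)%N by lia.
by rewrite mulrC mulrA.
Qed.

Lemma limit_weight_eqm1 j n : fps_eqm (2 * n + 1) (limit_weight j n) 1.
Proof.
rewrite /limit_weight addn1 -[1]mulr1; apply: fps_eqmM.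
  by apply: (@fps_eqm_leq _ _ (2 * n + 2)); [lia|apply: qpoch_inf_eqm1; lia].
apply: fps_eqm1V; rewrite expr2 -[1]mulr1.
by apply: fps_eqmM; apply: (@fps_eqm_leq _ _ (2 * n + 2 * j + 1));
   rewrite ?qpoch_inf_eqm1 //; try lia; apply: qpoch_inf_eqm1; lia.
Qed.

Lemma limit_series_small j n :
  fps_eqm n (q ^+ (2 * n) * limit_weight j n) 0.
Proof. by apply: (@fps_eqm_leq _ _ (2 * n)); [lia|apply: fps_eqmX0]. Qed.

Lemma limit_weight_telescope j N :
  (1 - q ^+ (2 * j + 1)) ^+ 2 * (\sum_(n < N) q ^+ (2 * n) * limit_weight j n)
  - q ^+ (4 * j + 4) * (\sum_(n < N) q ^+ (2 * n) * limit_weight j.+1 n)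
  = limit_weight j N * (1 - q ^+ (2 * N)) * (1 - q ^+ (2 * (2 * j + 1) + 2 * N)).
Proof.
have XE n : q ^+ (2 * n + 2 * j + 1) = q ^+ (2 * j + 1) * (q ^+ 2) ^+ n.
  by rewrite -exprM -exprD; congr (q ^+ _); lia.
have -> : q ^+ (4 * j + 4) = (q ^+ (2 * j + 1)) ^+ 2 * q ^+ 2.
  by rewrite -exprM -exprD; congr (q ^+ _); lia.
have -> : q ^+ (2 * (2 * j + 1) + 2 * N) = (q ^+ (2 * j + 1)) ^+ 2 * (q ^+ 2) ^+ N.
  by rewrite -!exprM -exprD; congr (q ^+ _); lia.
rewrite (exprM q 2 N).
rewrite -(@weighted_sum_telescope _ _ _ _ (limit_weight j.+1)).
- congr (_ * _ - _ * _); apply: eq_bigr => n _; congr (_ * _); exact: exprM.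
- by move=> n; rewrite -XE; apply: limit_weightSj.
- by move=> n; rewrite -XE -(limit_weightSn j n) -exprM; congr (_ * (1 - q ^+ _)); lia.
Qed.

Lemma limit_series_rec j :
  limit_series j * (1 - q ^+ (2 * j + 1)) ^+ 2 =
  1 + q ^+ (4 * j + 4) * limit_series j.+1.
Proof.
apply: fps_eqm_eq => N.
rewrite -[X in fps_eqm _ X _](subrK (q ^+ (4 * j + 4) * limit_series j.+1)).
apply: fps_eqmD (fps_eqm_refl _ _); rewrite mulrC.
have sumE i := fps_eqm_sum N (limit_series_small i).
apply: fps_eqm_trans (fps_eqmB (fps_eqmM (fps_eqm_refl _ _) (sumE _))
  (fps_eqmM (fps_eqm_refl _ _) (sumE _))) _.
(* All three factors of the telescoped boundary term are 1 modulo [q ^+ N]. *)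
rewrite limit_weight_telescope -[X in fps_eqm _ _ X]mulr1.
rewrite -[X in fps_eqm _ _ (X * _)]mulr1.
have XE a : (N <= a)%N -> fps_eqm N (1 - q ^+ a) 1.
  move=> leNa; apply: (fps_eqm_leq leNa).
  by exists (-1); rewrite mulrN1.
apply: fps_eqmM; last by apply: XE; lia.
apply: fps_eqmM; last by apply: XE; lia.
by apply: fps_eqm_leq (limit_weight_eqm1 _ _); lia.
Qed.

Lemma omega_tail_small j n :
  fps_eqm n (q ^+ (2 * n * (n + 1) + 4 * j * n)
             / qpoch (q ^+ (2 * j + 1)) (q ^+ 2) (n + 1) ^+ 2) 0.
Proof.
by apply: fps_eqm_leq (fps_eqmX0 _ _); nia.
Qed.

Lemma omega_tail_rec j :
  omega_tail j * (1 - q ^+ (2 * j + 1)) ^+ 2 =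
  1 + q ^+ (4 * j + 4) * omega_tail j.+1.
Proof.
have uA : (1 - q ^+ (2 * j + 1)) \is a GRing.unit by apply: one_subX_unit; lia.
apply: fps_eqm_eq => N.
have sumE i M := fps_eqm_sum M (omega_tail_small i).
(* Here [N.+1] terms are kept, against [N] on the other side, since the term of index 0 supplies the
   1. *)
apply: fps_eqm_trans (fps_eqmM (fps_eqm_leq (leqnSn N) (sumE _ _)) (fps_eqm_refl _ _)) _.
apply: fps_eqm_sym.
apply: fps_eqm_trans (fps_eqmD (fps_eqm_refl _ _)
  (fps_eqmM (fps_eqm_refl _ _) (sumE _ _))) _.
rewrite big_ord_recl mulrDl !muln0 mul0n expr0 mul1r qpochS /qpoch big_ord0 mulr1.
rewrite mulVr ?unitrX // mulr_sumr mulr_suml.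
rewrite (eq_bigr (fun n : 'I_N => q ^+ (2 * n.+1 * (n.+1 + 1) + 4 * j * n.+1)
  / qpoch (q ^+ (2 * j + 1)) (q ^+ 2) (n.+1 + 1) ^+ 2 * (1 - q ^+ (2 * j + 1)) ^+ 2)).
  exact: fps_eqm_refl.
move=> n _; rewrite [in RHS]addSn qpochS -exprD.
have -> : (2 * j + 1 + 2 = 2 * j.+1 + 1)%N by lia.
have uB : qpoch (q ^+ (2 * j.+1 + 1)) (q ^+ 2) (n + 1) \is a GRing.unit.
  by apply: qpoch_unit; lia.
rewrite divr_sqrMK // mulrA -exprD.
by congr (q ^+ _ / _); lia.
Qed.

Lemma omega_limit_series : omega = limit_series 0.
Proof.
have -> : omega = omega_tail 0.
  by rewrite /omega /omega_tail; congr fps_sum; apply: boolp.funext => n;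
     rewrite muln0 mul0n addn0 add0n expr1.
apply: fps_eqm_eq => N.
pose D j := omega_tail j - limit_series j.
rewrite -[omega_tail 0](subrK (limit_series 0)) -[X in fps_eqm _ _ X]add0r.
apply: fps_eqmD (fps_eqm_refl _ _).
(* In [D] the constant 1 of the two recurrences cancels; writing [q ^+ (4 * j + 4)] as
   [q * q ^+ (4 * j + 3)] exhibits the gained factor. *)
apply: (@fps_eqm_recr _ N (fun j => (1 - q ^+ (2 * j + 1)) ^+ 2)
  (fun j => q ^+ (4 * j + 3)) D).
  by move=> j; rewrite unitrX // one_subX_unit // addn1.
move=> j; rewrite /D mulrBl omega_tail_rec limit_series_rec.
by rewrite -exprS -addnS; ring.
Qed.

End OmegaAsLimit.

(** * The leading term of [q * omega - F_k1 k] *)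

Theorem theorem1p5 (k : nat) (hk : (0 < k)%N) :
  exists E : fps int,
    fps_coef E 0 = 1 /\
    fpsX * omega - F_k1 k = fpsX ^+ (2 * k + 1) * E.
Proof.
set q := @fpsX int.
(* A congruence one power beyond the leading term suffices: its cofactor [h] gives
   [E = 1 + q * h]. *)
suff [h Dh] : fps_eqm (2 * k + 2) (q * omega - F_k1 k) (q ^+ (2 * k + 1)).
  exists (1 + q ^+ 1 * h); split; first by rewrite fps_coefD fps_coefXnM addr0.
  by rewrite Dh mulrDr mulr1 mulrA -exprD -addnA.
(* [t] is the summand of [q * C_0]; [Q] isolates the dependence on [k]. *)
pose t n := q ^+ (2 * n + 1) * limit_weight 0 n.
pose Q n := qpoch_inf (q ^+ (2 * n + 2 * k)) (q ^+ 2).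
have F_E : F_k1 k = fps_sum (fun n => t n * Q n).
  rewrite /F_k1; congr fps_sum; apply: boolp.funext => n.
  by rewrite /t /Q /limit_weight muln0 addn0; ring.
have F_small n : fps_eqm n (t n * Q n) 0.
  rewrite /t -mulrA; apply: fps_eqm_leq (fps_eqmX0 _ _); lia.
set N := (2 * k + 2)%N.
rewrite omega_limit_series F_E.
apply: fps_eqm_trans (fps_eqmB (fps_eqmM (fps_eqm_refl _ _)
  (fps_eqm_sum N (limit_series_small 0))) (fps_eqm_sum N F_small)) _.
have -> : q * (\sum_(n < N) q ^+ (2 * n) * limit_weight 0 n)
    - \sum_(n < N) t n * Q n = \sum_(n < N) t n * (1 - Q n).
  rewrite mulr_sumr -sumrB; apply: eq_bigr => n _.
  by rewrite /t addn1 exprS; ring.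
rewrite /N addn2 big_ord_recl -[X in fps_eqm _ _ X]addr0; apply: fps_eqmD.
  (* The term of index 0: [1 - Q 0] starts with [q ^+ (2 * k)], and [t 0] contributes one more [q]
     and a weight with constant coefficient 1. *)
  have [h Qh] : fps_eqm (2 * k).+1 (1 - Q 0%N) (q ^+ (2 * k)).
    by apply: qpoch_inf_eqm_lead; rewrite ?muln_gt0.
  have -> : t 0%N * (1 - Q 0%N) =
      q ^+ (2 * k + 1) * (limit_weight 0 0 * (1 + q ^+ 1 * h)).
    rewrite Qh /t muln0 add0n (exprSr q (2 * k)) (exprD q (2 * k) 1) !expr1.
    by move: (q ^+ (2 * k)) => y; ring.
  rewrite -[X in fps_eqm _ _ X]mulr1 (_ : (2 * k).+2 = 2 * k + 1 + 1)%N; last by lia.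
  apply: fps_eqmXM; rewrite -[X in fps_eqm _ _ X]mulr1.
  apply: fps_eqmM; last by exists h.
  exact: (limit_weight_eqm1 0 0).
(* The other terms vanish modulo [q ^+ (2 * k + 2)]: at index [n.+1], the powers of [q] dividing [t]
   and [1 - Q] have total exponent [4 * n + 2 * k + 5]. *)
elim/big_rec: _ => [|n f _ f0]; first exact: fps_eqm_refl.
rewrite -[X in fps_eqm _ _ X]addr0; apply: fps_eqmD f0.
rewrite lift0; have [h Qh] : fps_eqm (2 * n.+1 + 2 * k) (Q n.+1) 1.
  by apply: qpoch_inf_eqm1; lia.
rewrite /t Qh.
have -> (w : fps int) : q ^+ (2 * n.+1 + 1) * w * (1 - (1 + q ^+ (2 * n.+1 + 2 * k) * h))
    = q ^+ (2 * n.+1 + 1 + (2 * n.+1 + 2 * k)) * (- w * h).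
  rewrite (exprD q (2 * n.+1 + 1)).
  by move: (q ^+ (2 * n.+1 + 1)) (q ^+ (2 * n.+1 + 2 * k)) => y z; ring.
by apply: fps_eqm_leq (fps_eqmX0 _ _); lia.
Qed.
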